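(* Let $z>0$, let $u_n(z)=\int_{-z}^{z}x^{2n}e^{-x^2}\,dx$ for $n\ge 0$, and let $S(t;z)=\sum_{n\ge 0}\frac{u_n(z)}{t^{2n+1}}$. Let $\phi(t;z)=t^{2}-z^{2}$ and $\psi(t;z)=2t\,\phi(t;z)$. Then $S$ satisfies the first order nonhomogeneous differential equation $$\phi(t;z)\,\partial_{t}S+\psi(t;z)\,S=\left[2\phi(t;z)-1\right]u_{0}(z)+2u_{1}(z).$$
   Context: $S(t;z)$ is the Stieltjes function of the linear functional $L[p]=\int_{-z}^{z}p(x)e^{-x^{2}}dx$, i.e. $S(t;z)=L\left[\frac{1}{t-x}\right]$ (with $L$ acting on the variable $x$), understood as a formal power series in $1/t$; $\partial_t$ acts termwise. *)

(* Defs.v *)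
From HB Require Import structures.
From mathcomp Require Import all_boot all_order all_algebra.
From mathcomp Require Import all_classical all_reals all_analysis.

Set Implicit Arguments.
Unset Strict Implicit.
Unset Printing Implicit Defensive.

Import Order.TTheory GRing.Theory Num.Theory.
Import numFieldNormedType.Exports.

Local Open Scope ring_scope.

(** Formal Laurent series in 1/t, i.e. the elements of R((1/t)): [f k] is the
    coefficient of t^k, and only finitely many positive powers of t occur. *)
Section FormalSeries.
Variable R : comNzRingType.

Definition upper_bounded : {pred int -> R} :=
  fun f => `[< exists N : nat, forall k : int, N%:Z < k -> f k = 0 >].

Lemma upper_boundedP (f : int -> R) :
  reflect (exists N : nat, forall k : int, N%:Z < k -> f k = 0)
          (f \in upper_bounded).
Proof. exact: asboolP. Qed.

Record fseries := FSeries {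
  fscoef :> int -> R;
  fscoef_bounded : fscoef \in upper_bounded }.

HB.instance Definition _ := [isSub for fscoef].
HB.instance Definition _ := [Choice of fseries by <:].

Lemma upper_bounded_zmod_closed : zmod_closed upper_bounded.
Proof.
split=> [|f g /upper_boundedP[M fM] /upper_boundedP[N gN]].
  by apply/upper_boundedP; exists 0%N.
apply/upper_boundedP; exists (maxn M N) => k kMN.
have Mk : M%:Z < k by apply: le_lt_trans kMN; rewrite lez_nat leq_maxl.
have Nk : N%:Z < k by apply: le_lt_trans kMN; rewrite lez_nat leq_maxr.
change (f k - g k = 0).
by rewrite fM // gN // subr0.
Qed.

HB.instance Definition _ :=
  GRing.SubChoice_isSubZmodule.Build _ _ fseries upper_bounded_zmod_closed.

Lemma fseriesP (f g : fseries) : (forall k, f k = g k) <-> f = g.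
Proof. by split=> [fg|->//]; apply: val_inj; apply/funext. Qed.

Lemma fsD (f g : fseries) k : (f + g) k = f k + g k. Proof. by []. Qed.
Lemma fsN (f : fseries) k : (- f) k = - f k. Proof. by []. Qed.
Lemma fs0 k : (0 : fseries) k = 0. Proof. by []. Qed.

Definition scale_coef (p : {poly R}) (f : int -> R) : int -> R :=
  fun k => \sum_(i < size p) p`_i * f (k - i%:Z).

Lemma scale_coef_bounded p (f : fseries) : scale_coef p f \in upper_bounded.
Proof.
have [N fN] := upper_boundedP _ (fscoef_bounded f).
apply/upper_boundedP; exists (N + size p)%N => k Nk.
apply: big1 => i _; rewrite fN ?mulr0 // ltrBrDr.
by apply: lt_trans Nk; rewrite -PoszD ltz_nat ltn_add2l.
Qed.

(** The product of a polynomial in t with a series. *)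
Definition fsscale (p : {poly R}) (f : fseries) := FSeries (scale_coef_bounded p f).

Lemma scale_coef_widen n (p : {poly R}) (f : int -> R) k : (size p <= n)%N ->
  scale_coef p f k = \sum_(i < n) p`_i * f (k - i%:Z).
Proof.
move=> pn; rewrite /scale_coef (big_ord_widen _ (fun i => p`_i * f (k - i%:Z)) pn).
rewrite big_mkcond; apply: eq_bigr => i _.
by case: ltnP => // pi; rewrite nth_default ?mul0r.
Qed.

Lemma fsscaleDl f p q : fsscale (p + q) f = fsscale p f + fsscale q f.
Proof.
apply/fseriesP => k; rewrite fsD /=.
pose n := maxn (size p) (size q).
rewrite (@scale_coef_widen n) ?size_polyD//.
rewrite (@scale_coef_widen n p) ?leq_maxl// (@scale_coef_widen n q) ?leq_maxr//.
by rewrite -big_split /=; apply: eq_bigr => i _; rewrite coefD mulrDl.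
Qed.

Lemma fsscaleDr p f g : fsscale p (f + g) = fsscale p f + fsscale p g.
Proof.
apply/fseriesP => k; rewrite fsD /= /scale_coef -big_split /=.
by apply: eq_bigr => i _; rewrite -mulrDr.
Qed.

Lemma fsscaleC c f k : fsscale c%:P f k = c * f k.
Proof.
rewrite /= (@scale_coef_widen 1) ?size_polyC_leq1//.
by rewrite big_ord1 coefC subr0.
Qed.

Lemma fsscaleMX p f k : fsscale (p * 'X) f k = fsscale p f (k - 1).
Proof.
rewrite /= (@scale_coef_widen (size p).+1); last first.
  by rewrite (leq_trans (size_polyMleq _ _))// size_polyX addn2.
rewrite big_ord_recl coefMX mul0r add0r; apply: eq_bigr => i _.
by rewrite coefMX /= /bump /= add1n /= intS opprD addrA.
Qed.

Lemma fsscaleA p q f : fsscale p (fsscale q f) = fsscale (p * q) f.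
Proof.
elim/poly_ind: p => [|p c IHp].
  rewrite mul0r; apply/fseriesP => k.
  by rewrite /= /scale_coef size_poly0 !big_ord0.
apply/fseriesP => k.
rewrite mulrDl !fsscaleDl !fsD mulrAC !fsscaleMX IHp; congr (_ + _).
rewrite fsscaleC mul_polyC /= [in RHS](@scale_coef_widen (size q)).
  rewrite mulr_sumr; apply: eq_bigr => i _; by rewrite coefZ mulrA.
exact: size_scale_leq.
Qed.

Lemma fsscale1 f : fsscale 1 f = f.
Proof. by apply/fseriesP => k; rewrite -polyC1 fsscaleC mul1r. Qed.

HB.instance Definition _ := GRing.Zmodule_isLmodule.Build {poly R} fseries
  fsscaleA fsscale1 fsscaleDr fsscaleDl.

Definition poly_coef (p : {poly R}) : int -> R :=
  fun k => if k is Posz n then p`_n else 0.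

Lemma poly_coef_bounded p : poly_coef p \in upper_bounded.
Proof.
apply/upper_boundedP; exists (size p) => -[n|n]//.
by rewrite ltz_nat => /ltnW pn; rewrite /poly_coef nth_default.
Qed.

(** A polynomial in t, viewed as a series. *)
Definition fspoly (p : {poly R}) := FSeries (poly_coef_bounded p).

Definition invt_coef (a : nat -> R) : int -> R :=
  fun k => match k with Posz 0 => a 0%N | Posz _ => 0 | Negz m => a m.+1 end.

Lemma invt_coef_bounded a : invt_coef a \in upper_bounded.
Proof. by apply/upper_boundedP; exists 0%N => -[[]|]. Qed.

(** The formal power series in 1/t given by the sum over m of a m / t ^ m. *)
Definition fsinvt (a : nat -> R) := FSeries (invt_coef_bounded a).

Definition deriv_coef (f : int -> R) : int -> R :=
  fun k => f (k + 1) *~ (k + 1).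

Lemma deriv_coef_bounded (f : fseries) : deriv_coef f \in upper_bounded.
Proof.
have [N fN] := upper_boundedP _ (fscoef_bounded f).
apply/upper_boundedP; exists N => k Nk.
by rewrite /deriv_coef fN ?mul0rz// (lt_trans Nk)// ltrDl.
Qed.

(** Termwise derivation with respect to t. *)
Definition fsderiv (f : fseries) := FSeries (deriv_coef_bounded f).

End FormalSeries.

Section TruncatedGaussian.
Variable R : realType.
Local Open Scope classical_set_scope.

Definition u (n : nat) (z : R) : R :=
  \int[lebesgue_measure]_(x in `[- z, z]) (x ^+ (2 * n) * expR (- x ^+ 2)).

(** The series of u_n(z) / t ^ (2n+1): only odd powers of 1/t occur. *)
Definition stieltjes (z : R) : fseries R :=
  fsinvt (fun m => if odd m then u m./2 z else 0).

Lemma stieltjes_coef z n : stieltjes z (Negz (2 * n)) = u n z.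
Proof. by rewrite /= mul2n /= odd_double /= uphalf_double. Qed.

Definition gaussL (z : R) (p : {poly R}) : R :=
  \int[lebesgue_measure]_(x in `[- z, z]) (p.[x] * expR (- x ^+ 2)).

Lemma continuous_gauss (p : {poly R}) :
  continuous (fun x : R => p.[x] * expR (- x ^+ 2)).
Proof.
move=> x; apply: cvgM; first exact: continuous_horner.
apply: continuous_comp; last exact: continuous_expR.
by apply: cvgN; apply: exprn_continuous.
Qed.

Lemma gaussL_odd z k : 0 <= z -> odd k -> gaussL z 'X^k = 0.
Proof.
move=> z0 ok; set g := fun x : R => 'X^k.[x] * expR (- x ^+ 2).
have gN x : g (- x) = - g x.
  by rewrite /g !hornerXn sqrrN exprNn -signr_odd ok expr1 mulN1r mulNr.
suff : gaussL z 'X^k = - gaussL z 'X^k.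
  by move=> /eqP; rewrite -addr_eq0 -mulr2n mulrn_eq0 => /eqP.
have cg (A : set R) : {within A, continuous g}.
  exact/continuous_subspaceT/continuous_gauss.
rewrite -[in RHS]mulN1r -RintegralZl//; last first.
  by apply: continuous_compact_integrable; [exact: segment_compact|exact: cg].
rewrite [LHS]/gaussL /Rintegral.
have zz : - z <= z by rewrite ge0_cp.
have {1}-> : `[- z, z] = `[- z, - - z]%classic by rewrite opprK.
rewrite (@integration_by_substitution_oppr _ g)//.
congr fine; apply: eq_integral => x _.
by rewrite /= mulN1r; congr EFin; exact: gN.
Qed.

(** Expanding 1/(t-x) in powers of 1/t and applying [gaussL] termwise gives
    the same series. *)
Lemma stieltjesE z : 0 <= z ->
  stieltjes z = fsinvt (fun m => if m is k.+1 then gaussL z 'X^k else 0).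
Proof.
move=> z0; congr fsinvt; apply/funext => -[//|k] /=.
case: ifPn => [ek|]; last by rewrite negbK => ok; rewrite gaussL_odd.
rewrite /u /gaussL; congr Rintegral; apply/funext => x.
by rewrite hornerXn uphalf_half (negbTE ek) add0n mul2n even_halfK.
Qed.

Definition phi (z : R) : {poly R} := 'X^2 - (z ^+ 2)%:P.

Definition psi (z : R) : {poly R} := 2 * 'X * phi z.

End TruncatedGaussian.

(* Main.v *)
(** The weight exp(-x^2) on [-z, z] is semiclassical: for every polynomial q,
    the derivative of (x^2 - z^2) q(x) exp(-x^2) integrates to zero, since
    x^2 - z^2 vanishes at both endpoints.  Taking q = x^m gives a three-term
    recurrence between the moments of orders m - 1, m + 1 and m + 3, which is
    the vanishing of the coefficient of t^-(m+1) on the left-hand side.  The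
    coefficients of t^0 and t^2 are read off directly, and that of t vanishes
    because the first moment does. *)

Require Import Defs.
From mathcomp Require Import all_boot all_order all_algebra.
From mathcomp Require Import all_classical all_reals all_analysis.
From mathcomp Require Import ring.

Set Implicit Arguments.
Unset Strict Implicit.
Unset Printing Implicit Defensive.

Import Order.TTheory GRing.Theory Num.Theory.
Import numFieldNormedType.Exports.

Local Open Scope ring_scope.

Lemma gaussL_integrable (R : realType) (z : R) (p : {poly R}) :
  lebesgue_measure.-integrable `[- z, z]
    (EFin \o (fun x : R => p.[x] * expR (- x ^+ 2))).
Proof.
apply: continuous_compact_integrable; first exact: segment_compact.
exact/continuous_subspaceT/continuous_gauss.
Qed.

Lemma gaussLD (R : realType) (z : R) (p q : {poly R}) :
  gaussL z (p + q) = gaussL z p + gaussL z q.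
Proof.
rewrite /gaussL -RintegralD//; [|exact: gaussL_integrable..].
by congr Rintegral; apply/funext => x; rewrite hornerD mulrDl.
Qed.

Lemma gaussLZ (R : realType) (z a : R) (p : {poly R}) :
  gaussL z (a *: p) = a * gaussL z p.
Proof.
rewrite /gaussL -RintegralZl//; last exact: gaussL_integrable.
by congr Rintegral; apply/funext => x; rewrite hornerZ mulrA.
Qed.

Lemma is_derive_gauss (R : realType) (p : {poly R}) (x : R) :
  is_derive x 1 (fun y : R => p.[y] * expR (- y ^+ 2))
    ((p^`() - 2 *: ('X * p)).[x] * expR (- x ^+ 2)).
Proof.
have dp : is_derive x 1 (horner p) p^`().[x] by exact: is_derive_poly.
have de : is_derive x 1 (fun y : R => expR (- y ^+ 2))
    (expR (- x ^+ 2) * - (2 * x)).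
  apply: (@is_derive1_comp _ expR (fun y : R => - y ^+ 2)).
  rewrite (_ : (fun y => _) = horner (- 'X^2)); last first.
    by apply/funext => y; rewrite !hornerE.
  apply: is_derive_eq (is_derive_poly (- 'X^2) x) _.
  by rewrite derivN derivXn expr1 !hornerE mulr_natl.
by apply: is_derive_eq; rewrite !hornerE /GRing.scale /=; ring.
Qed.

(** The integrand is the derivative of [p] times the weight, so only the endpoint values remain; the
    weight is even and factors out of them. *)
Lemma gaussL_deriv (R : realType) (z : R) (p : {poly R}) : 0 < z ->
  gaussL z (p^`() - 2 *: ('X * p)) = (p.[z] - p.[- z]) * expR (- z ^+ 2).
Proof.
move=> z0; rewrite /gaussL /Rintegral.
rewrite (@continuous_FTC2 _ _ (fun x => p.[x] * expR (- x ^+ 2))).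
- by rewrite sqrrN mulrBl.
- by rewrite gt0_cp.
- exact/continuous_subspaceT/continuous_gauss.
- split=> [x _||].
  + by have [] := is_derive_gauss p x.
  + exact/cvg_at_right_filter/continuous_gauss.
  + exact/cvg_at_left_filter/continuous_gauss.
- by move=> x _; rewrite derive1E; have [_ ->] := is_derive_gauss p x.
Qed.

Lemma gaussL_Pearson (R : realType) (z : R) (q : {poly R}) : 0 < z ->
  gaussL z ((phi z * q)^`() - 2 *: ('X * (phi z * q))) = 0.
Proof.
move=> z0; rewrite gaussL_deriv// /phi !hornerE sqrrN subrr !mul0r subrr.
by rewrite mul0r.
Qed.

(* The junk exponent [0.-1] carries the coefficient [0]. *)
Lemma gaussL_moment_rec (R : realType) (z : R) (m : nat) : 0 < z ->
  2 * gaussL z 'X^(m.+3) =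
  m.+2%:R * gaussL z 'X^(m.+1) - z ^+ 2 * (m%:R * gaussL z 'X^(m.-1))
  + 2 * z ^+ 2 * gaussL z 'X^(m.+1).
Proof.
move=> z0; have := gaussL_Pearson 'X^m z0.
(* The factors [m.+2] and [m] come from differentiating [phi z * 'X^m], the factors [2] from
   differentiating the weight. *)
rewrite [X in gaussL z X](_ : _ =
    - 2 *: 'X^(m.+3) + (m.+2%:R + 2 * z ^+ 2) *: 'X^(m.+1)
    + (- (z ^+ 2 * m%:R)) *: 'X^(m.-1)); last first.
  rewrite /phi mulrBl -exprD add2n mul_polyC derivB derivZ !derivXn /=.
  rewrite mulrBr -exprS -scalerAr -exprS scalerBr scalerA.
  rewrite -[_ *+ m.+2]scaler_nat -[_ *+ m]scaler_nat.
  by rewrite scalerA !scaleNr [(_ + 2 * _) *: _]scalerDl; ring.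
rewrite !gaussLD !gaussLZ => h.
by apply/eqP; rewrite -subr_eq0 -oppr_eq0; apply/eqP; rewrite -[RHS]h; ring.
Qed.

Section FormalSeries.
Variable R : comNzRingType.
Implicit Types (p : {poly R}) (f : fseries R).

Lemma scaleMX_coef p f k : (p * 'X *: f) k = (p *: f) (k - 1).
Proof. exact: fsscaleMX. Qed.

Lemma scaleC_coef c f k : (c%:P *: f) k = c * f k.
Proof. exact: fsscaleC. Qed.

Lemma scaleX_coef f k : ('X *: f) k = f (k - 1).
Proof. by rewrite -['X]mul1r scaleMX_coef scale1r. Qed.

(** The factor [k + 1] is zero at [k = -1]: a termwise derivative has no term in [1/t]. *)
Lemma fsderiv_Negz0 f : fsderiv f (Negz 0) = 0.
Proof. exact: mulr0z. Qed.

Lemma fsderiv_Negz f m : fsderiv f (Negz m.+1) = - (m.+1%:R * f (Negz m)).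
Proof.
rewrite /= /deriv_coef (_ : Negz m.+1 + 1 = Negz m); last by rewrite !NegzE; ring.
by rewrite [in X in _ *~ X]NegzE mulrNz -pmulrn mulr_natl.
Qed.

End FormalSeries.

Lemma phi_scale_coef (R : realType) (z : R) (f : fseries R) k :
  (phi z *: f) k = f (k - 2) - z ^+ 2 * f k.
Proof.
rewrite /phi scalerBl fsD fsN scaleC_coef expr2 scaleMX_coef scaleX_coef.
by rewrite -addrA -opprD.
Qed.

Lemma psi_scale_coef (R : realType) (z : R) (f : fseries R) k :
  (psi z *: f) k = 2 * (f (k - 3) - z ^+ 2 * f (k - 1)).
Proof.
(* Writing the factor 2 as a constant polynomial lets [scaleC_coef] apply. *)
have -> : psi z = 2%:P * (phi z * 'X) by rewrite /psi polyCMn; ring.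
rewrite -scalerA scaleC_coef scaleMX_coef phi_scale_coef.
by rewrite -addrA -opprD.
Qed.

Theorem proposition7 (R : realType) (z : R) (hz : 0 < z) :
  phi z *: fsderiv (stieltjes z) + psi z *: stieltjes z =
  fspoly ((2 * phi z - 1) * (u 0 z)%:P + (2 * u 1 z)%:P).
Proof.
have uE n : u n z = gaussL z 'X^(2 * n).
  by congr Rintegral; apply/funext => x; rewrite hornerXn.
apply/fseriesP => k; rewrite fsD phi_scale_coef psi_scale_coef.
(* With the odd moments kept as [gaussL], one recurrence serves every negative exponent, whatever
   its parity. *)
rewrite stieltjesE ?(ltW hz)// !uE.
rewrite (_ : _ * _ + _ = (2 * gaussL z 'X^0) *: 'X^2
    + (2 * gaussL z 'X^2 - gaussL z 'X^0 - 2 * z ^+ 2 * gaussL z 'X^0)%:P); last first.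
  by rewrite /phi muln0 muln1 -mul_polyC; ring.
case: k => [n|m]; last first.
  have -> : Negz m - 3 = Negz m.+3 by rewrite !NegzE; ring.
  have -> : Negz m - 2 = Negz m.+2 by rewrite !NegzE; ring.
  have -> : Negz m - 1 = Negz m.+1 by rewrite !NegzE; ring.
  (* At [m = 0] the derivative coefficient is the missing [1/t] term, matching the factor [m%:R] in
     the recurrence. *)
  case: m => [|m]; rewrite ?fsderiv_Negz0 !fsderiv_Negz /= mulrBr;
    by rewrite gaussL_moment_rec//=; ring.
rewrite /= !(coefD, coefZ, coefXn, coefC).
(* Exponents drop by at most 3 and the series starts at [1/t], so the left-hand side can be nonzero
   only for [n < 3]. *)
case: n => [|[|[|[|n]]]]; rewrite /= /deriv_coef /=.
(* The [-1] is the exponent of the leading term [u 0 z / t], whose derivative yields [- u 0 z]. *)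
- by rewrite (_ : 0 - 2 + 1 = -1 :> int)// mulrN1z !mul0rz; ring.
- by rewrite gaussL_odd ?(ltW hz)// !mul0rz; ring.
all: by rewrite !mul0rz; ring.
Qed.
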